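(* Let $(X,\rho)$ be a nonempty complete metric space, let $k\in\mathbb{N}$, $k\ge 1$, and let $\psi:X\to X$ be a $k$-continuous mapping. Suppose there is $\alpha\in\left[0,\frac12\right)$ such that for all $x,y\in X$, $$\rho(\psi^2x,\psi^2y)\le \alpha\left(\rho(x,\psi y)+\rho(y,\psi x)\right).$$ Then $\psi$ has a unique fixed point in $X$, and for every initial point $x\in X$ the iterative sequence $(\psi^n x)_{n\in\mathbb{N}}$ converges to this fixed point.
   Context: For a self-mapping $\psi:X\to X$, $\psi^n$ denotes the $n$-fold composition of $\psi$ with itself. A mapping $\psi:X\to X$ on a metric space is called $k$-continuous (for a natural number $k\ge 1$) if the iterate $\psi^k$ is continuous. *)

(* Defs.v *)
From HB Require Import structures.
From mathcomp Require Import all_boot all_order all_algebra.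
From mathcomp Require Import all_classical all_reals all_analysis.

Set Implicit Arguments.
Unset Strict Implicit.
Unset Printing Implicit Defensive.

Import Order.TTheory GRing.Theory Num.Theory.
Import numFieldNormedType.Exports.

Local Open Scope classical_set_scope.
Local Open Scope ring_scope.

(* Complete is the completeness of the uniform structure, that is, every proper
   Cauchy filter converges, and Metric ties that uniformity to the distance
   mdist through its balls. The base point carried by Complete makes the space
   nonempty. *)
#[short(type="completeMetricType")]
HB.structure Definition CompleteMetric (R : numDomainType) :=
  {T of Complete T & Metric R T}.

Definition k_continuous (T : topologicalType) (k : nat) (psi : T -> T) : Prop :=
  continuous (iter k psi).

(* Main.v *)
Require Import Defs.
From HB Require Import structures.
From mathcomp Require Import all_boot all_order all_algebra.
From mathcomp Require Import all_classical all_reals all_analysis.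
From mathcomp Require Import ring lra.

Set Implicit Arguments.
Unset Strict Implicit.
Unset Printing Implicit Defensive.

Import Order.TTheory GRing.Theory Num.Theory.
Import numFieldNormedType.Exports.

Local Open Scope classical_set_scope.
Local Open Scope ring_scope.

(** The inequality, applied to the consecutive iterates x_n and x_(n+1), loses
the term d(x_(n+1), x_(n+1)) = 0, and the triangle inequality bounds the other
one, so the steps d_n = d(x_n, x_(n+1)) of any orbit satisfy
d_(n+2) <= alpha (d_n + d_(n+1)).  As 2 alpha < 1, such a sequence decays
geometrically ([two_step_decay]); hence every orbit is Cauchy
([geometric_steps_cauchy]) and converges to some p.

Continuity is available only for psi^k, and shifting the orbit by k indices
gives psi^k p = p ([iter_lim_fixed]).  The orbit of p is thus periodic; its
steps also decay geometrically, and a periodic sequence tending to 0 vanishes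
([periodic_decay_eq0]), so d(p, psi p) = 0.  Two fixed points p, q satisfy
d(p, q) <= 2 alpha d(p, q) and coincide, so all the orbits share one limit. *)

(** The rate r = 1/2 + a works because, by the arithmetic-geometric mean
inequality, r^2 >= 2a >= a (1 + r), the last step because r < 1; any bound
c r^n valid at two consecutive indices therefore propagates to the next one. *)
Lemma two_step_decay (R : realFieldType) (a : R) (d : nat -> R) :
    0 <= a -> a < 1 / 2 -> (forall n, 0 <= d n) ->
    (forall n, d n.+2 <= a * (d n + d n.+1)) ->
  forall n, d n <= (d 0%N + 2 * d 1%N) * (1 / 2 + a) ^+ n.
Proof.
move=> a_ge0 a_lt d_ge0 d_rec; set c := _ + _; set r := _ + a.
have c_ge0 : 0 <= c by rewrite /c addr_ge0 ?mulr_ge0.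
have r_ge0 : 0 <= r by rewrite /r; lra.
have r2_ge : a * (1 + r) <= r ^+ 2 by rewrite /r; nra.
suff bound n : d n <= c * r ^+ n /\ d n.+1 <= c * r ^+ n.+1.
  by move=> n; have [] := bound n.
elim: n => [|n [dn dn1]].
  have d0_ge0 := d_ge0 0%N; have d1_ge0 := d_ge0 1%N.
  (* The factor 2 in c makes up for r, which may be as small as 1/2 *)
  by rewrite expr0 expr1; split; rewrite /c /r; nra.
split=> //; apply: le_trans (d_rec n) _.
apply: (@le_trans _ _ (a * (c * r ^+ n + c * r ^+ n.+1))).
  by rewrite ler_wpM2l// lerD.
have -> : a * (c * r ^+ n + c * r ^+ n.+1) = c * r ^+ n * (a * (1 + r)).
  by rewrite exprS; ring.
have -> : c * r ^+ n.+2 = c * r ^+ n * r ^+ 2 by rewrite !exprS; ring.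
by rewrite ler_wpM2l// mulr_ge0// exprn_ge0.
Qed.

Lemma periodic_decay_eq0 (R : realType) (d : nat -> R) (c r : R) (k : nat) :
    (0 < k)%N -> 0 <= r -> r < 1 -> (forall n, 0 <= d n) ->
    (forall n, d n <= c * r ^+ n) -> (forall n, d (n + k)%N = d n) ->
  d 0%N = 0.
Proof.
move=> k_gt0 r_ge0 r_lt1 d_ge0 d_le d_per; apply/eqP.
rewrite eq_le d_ge0 andbT.
have d_mul n : d (n * k)%N = d 0%N.
  by elim: n => // n IHn; rewrite mulSn addnC d_per.
have rk_lt1 : `|r ^+ k| < 1.
  by rewrite ger0_norm ?exprn_ge0// exprn_ilt1// -lt0n.
apply: (cvgr_to_ge (@cvg_geometric R c _ rk_lt1)); apply: nearW => n.
by rewrite /geometric /= -exprM mulnC -(d_mul n).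
Qed.

Lemma geometric_steps_cauchy (R : realType) (X : metricType R)
    (u : nat -> X) (c r : R) :
    0 <= r -> r < 1 -> (forall n, mdist (u n) (u n.+1) <= c * r ^+ n) ->
  cauchy (u @ \oo).
Proof.
move=> r_ge0 r_lt1 u_le; have r1_gt0 : 0 < 1 - r by rewrite subr_gt0.
have c_ge0 : 0 <= c.
  by apply: le_trans (mdist_ge0 (u 0%N) (u 1%N)) _; rewrite -[c]mulr1 (u_le 0%N).
pose b := c / (1 - r).
have b_ge0 : 0 <= b by rewrite divr_ge0// ltW.
(* Partial sums of the geometric series, kept exact so that they telescope *)
have tail m n : mdist (u m) (u (m + n)%N) <= b * (r ^+ m - r ^+ (m + n)).
  elim: n => [|n IHn]; first by rewrite addn0 mdistxx subrr mulr0.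
  rewrite addnS; apply: le_trans (metric_triangle _ (u (m + n)%N) _) _.
  apply: le_trans (lerD IHn (u_le _)) _.
  rewrite le_eqVlt; apply/orP; left; apply/eqP.
  by rewrite /b exprS; field; rewrite gt_eqF.
apply: cauchy_exP => e e_gt0.
have r_norm : `|r| < 1 by rewrite ger0_norm.
have /cvgr_lt/(_ e e_gt0) [N _ small] := @cvg_geometric R b _ r_norm.
exists (u N), N => // n /= N_le_n; rewrite ballEmdist /=.
rewrite -(subnKC N_le_n); apply: le_lt_trans (tail _ _) _.
apply: le_lt_trans (small N (leqnn N)).
by rewrite /geometric /= ler_wpM2l// gerBl exprn_ge0.
Qed.

(** The orbit shifted by k converges both to p, as a tail, and to f^k p.  As f may
be discontinuous at p, nothing better than periodicity of p follows. *)
Lemma iter_lim_fixed (T : topologicalType) (f : T -> T) (k : nat) (x p : T) :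
    hausdorff_space T -> continuous (iter k f) ->
    iter n f x @[n --> \oo] --> p ->
  iter k f p = p.
Proof.
move=> haus fk_cont x_p.
have shift_p : iter (k + n) f x @[n --> \oo] --> p.
  exact: cvg_comp (cvg_addnl k) x_p.
have shift_fp : iter (k + n) f x @[n --> \oo] --> iter k f p.
  under eq_fun do rewrite iterD.
  exact: (cvg_comp _ _ x_p (fk_cont p)).
exact: (cvg_unique haus shift_fp shift_p).
Qed.

Theorem theorem2p1 (R : realType) (X : completeMetricType R) (k : nat)
    (k_ge1 : (1 <= k)%N) (psi : X -> X) (psi_cont : k_continuous k psi)
    (alpha : R) (alpha_ge0 : 0 <= alpha) (alpha_lt : alpha < 1 / 2)
    (psi_contr : forall x y : X,
      mdist (iter 2 psi x) (iter 2 psi y) <=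
        alpha * (mdist x (psi y) + mdist y (psi x))) :
  exists p : X,
    [/\ psi p = p,
        (forall q : X, psi q = q -> q = p) &
        (forall x : X, iter n psi x @[n --> \oo] --> p)].
Proof.
pose r := 1 / 2 + alpha.
have r_ge0 : 0 <= r by rewrite /r; lra.
have r_lt1 : r < 1 by rewrite /r; lra.
pose step x n := mdist (iter n psi x) (iter n.+1 psi x).
have step_ge0 x n : 0 <= step x n by exact: mdist_ge0.
have step_rec x n : step x n.+2 <= alpha * (step x n + step x n.+1).
  apply: le_trans (psi_contr (iter n psi x) (iter n.+1 psi x)) _.
  by rewrite mdistxx addr0 ler_wpM2l// metric_triangle.
have step_le x := two_step_decay alpha_ge0 alpha_lt (step_ge0 x) (step_rec x).
have orbit_lim x : exists2 p, iter n psi x @[n --> \oo] --> p & psi p = p.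
  have /cauchy_cvg x_cvg := geometric_steps_cauchy r_ge0 r_lt1 (step_le x).
  set p := lim _ in x_cvg; exists p => //.
  have psik_p := iter_lim_fixed (@metric_hausdorff _ X) psi_cont x_cvg.
  have step_per n : step p (n + k)%N = step p n.
    by rewrite /step -addSn !iterD psik_p.
  apply/esym/(@mdist_positivity R X).
  exact: (periodic_decay_eq0 k_ge1 r_ge0 r_lt1 (step_ge0 p) (step_le p) step_per).
have fixed_unique p q : psi p = p -> psi q = q -> q = p.
  move=> fp fq; apply: (@mdist_positivity R X); apply/eqP.
  rewrite eq_le mdist_ge0 andbT.
  (* The inequality reads d(q, p) <= 2 alpha d(q, p) at fixed points *)
  have := psi_contr q p; rewrite /= !(fp, fq) (metric_sym p q).
  by have := mdist_ge0 q p; nra.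
have [p _ fp] := orbit_lim point.
exists p; split=> // [q fq|x]; first exact: fixed_unique.
by have [q x_q fq] := orbit_lim x; rewrite -(fixed_unique p q).
Qed.
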